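(* Dependence logic is precisely as expressive as exclusion logic, both with respect to definability of sets of teams and with respect to sentences. That is: for every dependence logic formula $\phi$ there is an exclusion logic formula $\phi'$, and for every exclusion logic formula $\phi$ there is a dependence logic formula $\phi'$, such that $M\models_X\phi\Leftrightarrow M\models_X\phi'$ for all models $M$ of the relevant signature and all teams $X$ over $M$ whose domain contains the free variables of both formulas; and likewise every sentence $\phi$ of either logic has a sentence $\phi'$ of the other logic such that $M\models_{\{\emptyset\}}\phi\Leftrightarrow M\models_{\{\emptyset\}}\phi'$ for all models $M$ of the relevant signature.
   Context: All first order models are assumed to have at least two elements in their domain; $\mathrm{Dom}(M)$ is the domain of $M$. An assignment over $M$ is a function from a set of variables to $\mathrm{Dom}(M)$; $s[m/x]$ is the assignment which sends $x$ to $m$ and otherwise agrees with $s$; $t\langle s\rangle$ is the value of the term $t$ in $M$ under $s$, and $\vec t\langle s\rangle$ is the corresponding tuple of values. A team $X$ over $M$ is a set of assignments over $M$ all having the same domain, called the domain of $X$. $\{\emptyset\}$ is the team containing only the empty assignment. All formulas are in negation normal form and are built using $\wedge,\vee,\exists x,\forall x$ from first order literals together with: for dependence logic, dependence atoms $=\!(t_1,\ldots,t_n)$ ($n\geq 1$, $t_i$ terms); for exclusion logic, exclusion atoms $\vec t_1 ~|~ \vec t_2$ (with $\vec t_1,\vec t_2$ finite tuples of terms of the same length). The satisfaction relation $M\models_X\phi$ (lax team semantics), where the domain of $X$ contains the free variables of $\phi$, is: - for a first order literal $\phi$: $M\models_s\phi$ (Tarski) for all $s\in X$; - $M\models_X =\!(t_1,\ldots,t_n)$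 iff for all $s,s'\in X$ with $t_i\langle s\rangle=t_i\langle s'\rangle$ for $i=1,\ldots,n-1$, we have $t_n\langle s\rangle=t_n\langle s'\rangle$; - $M\models_X \vec t_1~|~\vec t_2$ iff for all $s,s'\in X$, $\vec t_1\langle s\rangle\neq\vec t_2\langle s'\rangle$; - $M\models_X\psi\vee\theta$ iff $X=Y\cup Z$ for some teams $Y,Z$ with $M\models_Y\psi$ and $M\models_Z\theta$; - $M\models_X\psi\wedge\theta$ iff $M\models_X\psi$ and $M\models_X\theta$; - $M\models_X\exists x\psi$ iff there is $H:X\to\mathcal P(\mathrm{Dom}(M))\setminus\{\emptyset\}$ with $M\models_{X[H/x]}\psi$, where $X[H/x]=\{s[m/x]:s\in X,\ m\in H(s)\}$; - $M\models_X\forall x\psi$ iff $M\models_{X[M/x]}\psi$, where $X[M/x]=\{s[m/x]:s\in X,\ m\in\mathrm{Dom}(M)\}$. *)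

(* Defs.v *)
From mathcomp Require Import all_boot.
From mathcomp Require Import boolp classical_sets.

Set Implicit Arguments.
Unset Strict Implicit.
Unset Printing Implicit Defensive.

Local Open Scope classical_set_scope.

Definition var := nat.

Record signature := Signature {
  fsym : Type;
  rsym : Type;
  farity : fsym -> nat;
  rarity : rsym -> nat }.

Inductive term (S : signature) : Type :=
| Var of var
| App (f : fsym S) of 'I_(farity f) -> term S.

Fixpoint tvars (S : signature) (t : term S) : set var :=
  match t with
  | Var x => [set x]
  | App _ args => [set x | exists i, tvars (args i) x]
  end.

Definition seq_tvars (S : signature) (ts : seq (term S)) : set var :=
  foldr (fun t V => tvars t `|` V) set0 ts.

Record model (S : signature) := Model {
  Dom :> Type;
  fint : forall f : fsym S, (farity f).-tuple Dom -> Dom;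
  rint : forall R : rsym S, (rarity R).-tuple Dom -> Prop;
  Dom_ge2 : exists a b : Dom, a <> b }.

(* An assignment is a partial function on variables; its domain is the set of
   variables on which it is not [None]. *)
Definition assignment (S : signature) (M : model S) := var -> option M.

Definition empty_assignment (S : signature) (M : model S) : assignment M :=
  fun=> None.

Definition update (S : signature) (M : model S) (s : assignment M) (x : var)
    (m : M) : assignment M :=
  fun y => if y == x then Some m else s y.

(* [Some] of the tuple of underlying values when all [n] entries are [Some];
   otherwise [pmap] drops an entry, the length is wrong, and [insub] is [None]. *)
Definition otuple (A : Type) (n : nat) (v : n.-tuple (option A)) :
    option (n.-tuple A) :=
  insub (pmap id v).

(* [None] exactly when some variable of [t] is outside the domain of [s]. *)
Fixpoint tval (S : signature) (M : model S) (s : assignment M) (t : term S) :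
    option M :=
  match t with
  | Var x => s x
  | App f args => omap (@fint S M f) (otuple [tuple tval s (args i) | i < farity f])
  end.

Inductive literal (S : signature) : Type :=
| Rel (R : rsym S) of (rarity R).-tuple (term S)
| NRel (R : rsym S) of (rarity R).-tuple (term S)
| Eq of term S & term S
| Neq of term S & term S.

Definition lvars (S : signature) (l : literal S) : set var :=
  match l with
  | Rel _ ts | NRel _ ts => seq_tvars ts
  | Eq t1 t2 | Neq t1 t2 => tvars t1 `|` tvars t2
  end.

Definition lsat (S : signature) (M : model S) (s : assignment M)
    (l : literal S) : Prop :=
  match l with
  | Rel R ts =>
      exists2 v, otuple (map_tuple (tval s) ts) = Some v & @rint S M R v
  | NRel R ts =>
      exists2 v, otuple (map_tuple (tval s) ts) = Some v & ~ @rint S M R v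
  | Eq t1 t2 => tval s t1 = tval s t2
  | Neq t1 t2 => tval s t1 <> tval s t2
  end.

Inductive logic := Dependence | Exclusion.

(* [DepAtom [:: t_1; ..; t_(n-1)] t_n] is =(t_1, .., t_n), whence n >= 1. *)
Inductive atom (S : signature) : logic -> Type :=
| DepAtom of seq (term S) & term S : atom S Dependence
| ExcAtom (n : nat) of n.-tuple (term S) & n.-tuple (term S) :
    atom S Exclusion.

Definition avars (S : signature) (L : logic) (a : atom S L) : set var :=
  match a with
  | DepAtom ts t => seq_tvars ts `|` tvars t
  | ExcAtom _ ts1 ts2 => seq_tvars ts1 `|` seq_tvars ts2
  end.

Definition asat (S : signature) (M : model S) (X : set (assignment M))
    (L : logic) (a : atom S L) : Prop :=
  match a with
  | DepAtom ts t => forall s s', X s -> X s' ->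
      map (tval s) ts = map (tval s') ts -> tval s t = tval s' t
  | ExcAtom _ ts1 ts2 => forall s s', X s -> X s' ->
      map (tval s) ts1 <> map (tval s') ts2
  end.

Inductive formula (S : signature) (L : logic) : Type :=
| Lit of literal S
| Atom of atom S L
| And of formula S L & formula S L
| Or of formula S L & formula S L
| Ex of var & formula S L
| All of var & formula S L.

Fixpoint FV (S : signature) (L : logic) (phi : formula S L) : set var :=
  match phi with
  | Lit l => lvars l
  | Atom a => avars a
  | And psi theta | Or psi theta => FV psi `|` FV theta
  | Ex x psi | All x psi => FV psi `\ x
  end.

Definition sentence (S : signature) (L : logic) (phi : formula S L) : Prop :=
  FV phi = set0.

(* [X] is a team with domain [D]. Every [D] is a domain of the empty team. *)
Definition team (S : signature) (M : model S) (D : set var)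
    (X : set (assignment M)) : Prop :=
  forall s, X s -> forall x, D x <-> s x <> None.

(* The team X[H/x]; only the values of [H] on [X] matter. *)
Definition supplement (S : signature) (M : model S) (X : set (assignment M))
    (H : assignment M -> set M) (x : var) : set (assignment M) :=
  [set s' | exists s m, [/\ X s, H s m & s' = update s x m]].

Definition duplicate (S : signature) (M : model S) (X : set (assignment M))
    (x : var) : set (assignment M) :=
  supplement X (fun=> setT) x.

(* Meant for teams whose domain contains [FV phi]. In the clause for [Or], [Y]
   and [Z] are subsets of [X], hence teams with the same domain. *)
Fixpoint sat (S : signature) (L : logic) (M : model S) (X : set (assignment M))
    (phi : formula S L) : Prop :=
  match phi with
  | Lit l => forall s, X s -> lsat s l
  | Atom a => asat X a
  | And psi theta => sat X psi /\ sat X theta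
  | Or psi theta => exists Y Z, [/\ X = Y `|` Z, sat Y psi & sat Z theta]
  | Ex x psi => exists H : assignment M -> set M,
      (forall s, X s -> H s !=set0) /\ sat (supplement X H x) psi
  | All x psi => sat (duplicate X x) psi
  end.

Definition team_equiv (S : signature) (L L' : logic) (phi : formula S L)
    (phi' : formula S L') : Prop :=
  forall (M : model S) (D : set var) (X : set (assignment M)),
    team D X -> FV phi `<=` D -> FV phi' `<=` D -> (sat X phi <-> sat X phi').

Definition sentence_equiv (S : signature) (L L' : logic) (phi : formula S L)
    (phi' : formula S L') : Prop :=
  forall M : model S,
    sat [set empty_assignment M] phi <-> sat [set empty_assignment M] phi'.

(* Main.v *)
From mathcomp Require Import all_boot.
From mathcomp Require Import boolp classical_sets.
Require Import Defs.

(** Both translations act on atoms only and preserve free variables.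
    A dependence atom =(ts, t) is [forall z (z = t \/ (z, ts) | (t, ts))]:
    a value [z] different from [t] in one assignment is never the value of [t]
    in an assignment with the same [ts].
    An exclusion atom [ts1 | ts2] is
    [forall zs exists u1 u2 (=(zs, u1) /\ =(zs, u2) /\
       ((u1 = u2 /\ zs <> ts1) \/ (u1 <> u2 /\ zs <> ts2)))]:
    the truth value of [u1 = u2] is a function of [zs] and chooses a set of
    tuples containing no value of [ts1], whose complement contains no value
    of [ts2]. *)

Set Implicit Arguments.
Unset Strict Implicit.
Unset Printing Implicit Defensive.

Local Open Scope classical_set_scope.

(** * Variables and values of terms *)

Section Terms.
Variable S : signature.
Implicit Types (M : model S) (t : term S) (ts : seq (term S)).

(** Source of fresh variables: a symbol has finitely many arguments, so their bounds have a
    maximum. *)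
Lemma tvars_bounded t : exists b, forall x, tvars t x -> (x < b)%N.
Proof.
elim: t => [x|f args /choice[b bP]]; first by exists x.+1 => y /= ->.
exists (\max_i b i) => x /= [i xi].
by apply: leq_trans (bP i x xi) _; exact: leq_bigmax.
Qed.

Lemma seq_tvars_bounded ts : exists b, forall x, seq_tvars ts x -> (x < b)%N.
Proof.
elim: ts => [|t ts [b bP]]; first by exists 0%N.
have [c cP] := tvars_bounded t; exists (maxn c b) => x /= [/cP|/bP] xlt.
  by rewrite leq_max xlt.
by rewrite leq_max xlt orbT.
Qed.

Lemma tval_agree M (s s' : assignment M) t :
  (forall x, tvars t x -> s x = s' x) -> tval s t = tval s' t.
Proof.
elim: t => [x|f args IH] /= ss'; first exact: ss'.
congr (omap _ (otuple _)); apply: eq_from_tnth => i.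
by rewrite !tnth_mktuple; apply: IH => x xi; apply: ss'; exists i.
Qed.

Lemma map_tval_agree M (s s' : assignment M) ts :
  (forall x, seq_tvars ts x -> s x = s' x) ->
  map (tval s) ts = map (tval s') ts.
Proof.
elim: ts => [//|t ts IH] /= ss'; congr (_ :: _).
  by apply: tval_agree => x xt; apply: ss'; left.
by apply: IH => x xt; apply: ss'; right.
Qed.

Lemma otuple_Some (A : Type) n (v : n.-tuple A) :
  otuple (map_tuple Some v) = Some v.
Proof. by rewrite /otuple /= map_pK //; exact: valK. Qed.

Lemma tval_defined M (s : assignment M) t :
  (forall x, tvars t x -> s x <> None) -> exists m, tval s t = Some m.
Proof.
elim: t => [x|f args IH] /= sD.
  by case: (s x) (sD x erefl) => // m _; exists m.
have /choice[v vP] i : exists m, tval s (args i) = Some m.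
  by apply: IH => x xi; apply: sD; exists i.
exists (fint (mktuple v)).
suff -> : [tuple tval s (args i) | i < farity f] = map_tuple Some (mktuple v).
  by rewrite otuple_Some.
by apply: eq_from_tnth => i; rewrite [RHS]tnth_map !tnth_mktuple.
Qed.

Lemma map_tval_defined M (s : assignment M) ts :
  (forall x, seq_tvars ts x -> s x <> None) ->
  exists vs : seq M, map (tval s) ts = map Some vs.
Proof.
elim: ts => [|t ts IH] /= sD; first by exists [::].
have [|vs ->] := IH; first by move=> x xt; apply: sD; right.
have [|m ->] := @tval_defined M s t; first by move=> x xt; apply: sD; left.
by exists (m :: vs).
Qed.

Lemma seq_tvars_Var (zs : seq var) :
  seq_tvars [seq Var S z | z <- zs] = [set x | x \in zs].
Proof.
elim: zs => [|z zs IH] /=; first by apply/seteqP; split.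
rewrite IH; apply/seteqP; split=> x /=; rewrite inE.
  by case=> [->|->]; rewrite ?eqxx ?orbT.
by case/orP=> [/eqP|]; [left|right].
Qed.

End Terms.

(** * Lifting a translation of atoms to formulas and sentences *)

Section Formulas.
Variables (S : signature).
Implicit Types (M : model S).

Lemma update_eq M (s : assignment M) x m : update s x m x = Some m.
Proof. by rewrite /update eqxx. Qed.

Lemma update_neq M (s : assignment M) x y m :
  y <> x -> update s x m y = s y.
Proof. by rewrite /update => /eqP/negbTE ->. Qed.

Lemma team_supplement M D (X : set (assignment M)) H x :
  team D X -> team (x |` D) (supplement X H x).
Proof.
move=> XD _ [s [m [Xs _ ->]]] y; rewrite /update /=.
case: eqP => [->|yx]; first by split=> // _; left.
by rewrite -(XD s Xs); split=> [[]//|]; right.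
Qed.

Lemma team_sub M D (X Y : set (assignment M)) :
  Y `<=` X -> team D X -> team D Y.
Proof. by move=> YX XD s /YX; exact: XD. Qed.

Lemma team_equiv_atoms (L L' : logic) :
  (forall a : atom S L, exists phi' : formula S L',
     FV phi' = avars a /\ team_equiv (Atom a) phi') ->
  forall phi : formula S L, exists phi' : formula S L',
    FV phi' = FV phi /\ team_equiv phi phi'.
Proof.
move=> atomP; elim.
- by move=> l; exists (Lit L' l); split.
- exact: atomP.
- move=> p [p' [pF pE]] q [q' [qF qE]]; exists (And p' q').
  split=> [|M D X XD /= + _]; first by rewrite /= pF qF.
  rewrite subUset => -[pD qD].
  by rewrite (pE M D X XD) ?(qE M D X XD) ?pF ?qF.
- move=> p [p' [pF pE]] q [q' [qF qE]]; exists (Or p' q').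
  split=> [|M D X XD /= + _]; first by rewrite /= pF qF.
  rewrite subUset => -[pD qD].
  by split=> -[Y [Z [XYZ pY qZ]]]; exists Y, Z; split=> //;
    [move: pY|move: qZ|move: pY|move: qZ];
    rewrite (pE M D Y, qE M D Z) ?pF ?qF //;
    apply: team_sub XD; rewrite XYZ => s; [left|right|left|right].
- move=> x p [p' [pF pE]]; exists (Ex x p').
  split=> [|M D X XD /= pD _]; first by rewrite /= pF.
  have {}pD : FV p `<=` x |` D.
    by move=> y py; have [->|yx] := pselect (y = x); [left|right; exact: pD].
  by split=> -[H [H0 pH]]; exists H; split=> //; move: pH;
    rewrite (pE M _ _ (team_supplement XD)) ?pF.
- move=> x p [p' [pF pE]]; exists (All x p').
  split=> [|M D X XD /= pD _]; first by rewrite /= pF.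
  have {}pD : FV p `<=` x |` D.
    by move=> y py; have [->|yx] := pselect (y = x); [left|right; exact: pD].
  by rewrite (pE M _ _ (team_supplement XD)) ?pF.
Qed.

Lemma sentence_equiv_of_team_equiv (L L' : logic) (phi : formula S L)
    (phi' : formula S L') :
  FV phi' = FV phi -> sentence phi -> team_equiv phi phi' ->
  sentence phi' /\ sentence_equiv phi phi'.
Proof.
move=> phiF phi0 E; split=> [|M]; first by rewrite /sentence phiF.
(* The team of the empty assignment has domain [set0]. *)
by apply: (E M set0); rewrite ?phiF ?phi0 // => _ -> x; split.
Qed.

(** * Blocks of universal quantifiers and inequality of tuples *)

Definition Alls L (zs : seq var) (phi : formula S L) : formula S L :=
  foldr (@All S L) phi zs.

Lemma FV_Alls L zs (phi : formula S L) :
  FV (Alls zs phi) = FV phi `\` [set x | x \in zs].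
Proof.
elim: zs => [|z zs IH] /=; first by apply/seteqP; split=> [x ?|x []].
rewrite IH; apply/seteqP; split=> x /=; rewrite inE.
  by case=> -[fx xzs] /eqP/negbTE xz; rewrite xz.
by case=> fx /negP; rewrite negb_or => /andP[/eqP xz /negP xzs].
Qed.

Definition duplicates M (X : set (assignment M)) (zs : seq var) :=
  foldl (@duplicate S M) X zs.

Lemma sat_Alls L zs (phi : formula S L) M (X : set (assignment M)) :
  sat X (Alls zs phi) = sat (duplicates X zs) phi.
Proof. by elim: zs X => [//|z zs IH] X /=; rewrite IH. Qed.

Lemma duplicates_origin M (X : set (assignment M)) zs w :
  duplicates X zs w ->
  exists2 s, X s & forall x, x \notin zs -> w x = s x.
Proof.
elim: zs X => [|z zs IH] X /=; first by exists w.
case/IH=> _ [s [m [Xs _ ->]]] ws; exists s => // x.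
rewrite inE negb_or => /andP[/eqP xz xzs].
by rewrite ws // update_neq.
Qed.

(** The values are assigned from the outermost quantifier inwards; [uniq zs] ensures that no later
    one overwrites an earlier value. *)
Lemma duplicates_values M (X : set (assignment M)) zs s (vs : seq M) :
  uniq zs -> size vs = size zs -> X s ->
  exists w, [/\ duplicates X zs w, map w zs = map Some vs &
                forall x, x \notin zs -> w x = s x].
Proof.
elim: zs vs X s => [|z zs IH] [|m vs] X s //=; first by exists s.
case/andP=> zzs Uzs [vsE] Xs.
have [|w [Xw wzs ws]] := IH vs (duplicate X z) (update s z m) Uzs vsE.
  by exists s, m.
exists w; split=> // [|x]; first by rewrite wzs ws // update_eq.
by rewrite inE negb_or => /andP[/eqP xz xzs]; rewrite ws // update_neq.
Qed.

(* [u <> u] is the empty disjunction; it brings in the free variable [u]. *)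
Fixpoint neq_terms L (u : var) (ts1 ts2 : seq (term S)) : formula S L :=
  match ts1, ts2 with
  | t1 :: ts1', t2 :: ts2' =>
      Or (Lit L (Neq t1 t2)) (neq_terms L u ts1' ts2')
  | _, _ => Lit L (Neq (Var S u) (Var S u))
  end.

Lemma FV_neq_terms L u ts1 ts2 : size ts1 = size ts2 ->
  FV (neq_terms L u ts1 ts2) = u |` (seq_tvars ts1 `|` seq_tvars ts2).
Proof.
elim: ts1 ts2 => [|t1 ts1 IH] [|t2 ts2] //=; first by rewrite setUid setUid setU0.
by case=> /IH ->; apply/seteqP; split=> x /=; tauto.
Qed.

(** The team is split by whether the first coordinates differ, and the induction handles the rest.
    For empty tuples both sides force [X] to be empty. *)
Lemma sat_neq_terms L u ts1 ts2 M (X : set (assignment M)) :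
  size ts1 = size ts2 ->
  sat X (neq_terms L u ts1 ts2) <->
  forall s, X s -> map (tval s) ts1 <> map (tval s) ts2.
Proof.
elim: ts1 ts2 X => [|t1 ts1 IH] [|t2 ts2] X //=.
  by move=> _; split=> XF s /XF.
case=> sz; split=> [[Y [Z [-> Yt /(IH _ _ sz) Zts]]] s [Ys|Zs] []|Xts].
- by move/(_ s Ys): Yt.
- by move=> _; exact: Zts.
exists (X `&` [set s | tval s t1 <> tval s t2]),
       (X `&` [set s | tval s t1 = tval s t2]).
split=> [||]; last 2 first.
- by move=> s [].
- by apply/(IH _ _ sz) => s [Xs E] Es; apply: (Xts s Xs); rewrite E Es.
apply/seteqP; split=> s; last by case=> -[].
by move=> Xs; have [E|E] := pselect (tval s t1 = tval s t2); [right|left].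
Qed.

(** * Translations of the two atoms *)

Lemma DepAtom_as_exclusion (ts : seq (term S)) (t : term S) :
  exists phi : formula S Exclusion,
    FV phi = avars (DepAtom ts t) /\ team_equiv (Atom (DepAtom ts t)) phi.
Proof.
have [z zP] := seq_tvars_bounded (t :: ts).
exists (All z (Or (Lit _ (Eq (Var S z) t))
  (Atom (ExcAtom [tuple of Var S z :: in_tuple ts]
                 [tuple of t :: in_tuple ts])))).
have zt x : tvars t x -> x <> z.
  by move=> xt xz; have := zP x (or_introl xt); rewrite xz ltnn.
have zts x : seq_tvars ts x -> x <> z.
  by move=> xt xz; have := zP x (or_intror xt); rewrite xz ltnn.
split=> [|M D X XD /=].
  apply/seteqP; split=> x /=; first tauto.
  by case=> xt; split; [tauto|exact: zts|tauto|exact: zt].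
rewrite subUset => -[tsD tD] _.
have tE (s : assignment M) m : tval (update s z m) t = tval s t.
  by apply: tval_agree => x /zt; exact: update_neq.
have tsE (s : assignment M) m :
    map (tval (update s z m)) ts = map (tval s) ts.
  by apply: map_tval_agree => x /zts; exact: update_neq.
(* The quantified [z] ranges over [M], so a value of [t] can be given to [z] only once it is known
   not to be [None]. *)
have td s : X s -> exists m, tval s t = Some m.
  by move=> Xs; apply: tval_defined => x /tD; rewrite (XD s Xs).
split=> [dep|[Y [Z [XYZ Yt Zts]]] s s' Xs Xs' Ets].
  exists (duplicate X z `&` [set s | s z = tval s t]),
         (duplicate X z `&` [set s | s z <> tval s t]).
  split=> [|s []//|_ _ [[s [m [Xs _ ->]]] /=] + [[s' [m' [Xs' _ ->]]] _]].
    apply/seteqP; split=> s; last by case=> -[].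
    by move=> Xs; have [E|E] := pselect (s z = tval s t); [left|right].
  rewrite !tE !tsE => sm [sm' Ets].
  by apply: sm; rewrite sm'; apply: dep.
apply: contrapT => Et.
(* If [s] and [s'] agree on [ts] but not on [t], let [z] take in each the value of [t] in the other.
   Both extensions fail [z = t], so both lie in [Z], where they violate the exclusion atom. *)
have [m tm] := td _ Xs; have [m' tm'] := td _ Xs'.
have inZ r k : X r -> Some k <> tval r t -> Z (update r z k).
  move=> Xr kr.
  have : duplicate X z (update r z k) by exists r, k.
  rewrite XYZ => -[/Yt /=|//].
  by rewrite update_eq tE.
apply: (Zts (update s z m') (update s' z m)).
- by apply: inZ => //; rewrite -tm' => /esym.
- by apply: inZ => //; rewrite -tm.
by rewrite /= update_eq tE !tsE Ets tm'.
Qed.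

Lemma ExcAtom_as_dependence n (ts1 ts2 : n.-tuple (term S)) :
  exists phi : formula S Dependence,
    FV phi = avars (ExcAtom ts1 ts2) /\
    team_equiv (Atom (ExcAtom ts1 ts2)) phi.
Proof.
have [b1 b1P] := seq_tvars_bounded ts1.
have [b2 b2P] := seq_tvars_bounded ts2.
(* All variables of [ts1] and [ts2] lie below [b]; [b] and [b.+1] serve as [u1] and [u2], and the
   block [zs] starts after them. The variable [u1] that [neq_terms] brings in is bound by [Ex u1],
   so it does not become free. *)
pose b := maxn b1 b2; pose zs := iota b.+2 n; pose Vzs := map (Var S) zs.
pose u1 := b; pose u2 := b.+1.
exists (Alls zs (Ex u1 (Ex u2
  (And (Atom (DepAtom Vzs (Var S u1)))
  (And (Atom (DepAtom Vzs (Var S u2)))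
    (Or (And (Lit _ (Eq (Var S u1) (Var S u2)))
             (neq_terms _ u1 Vzs ts1))
        (And (Lit _ (Neq (Var S u1) (Var S u2)))
             (neq_terms _ u1 Vzs ts2)))))))).
have sz1 : size Vzs = size ts1 by rewrite !size_map size_iota size_tuple.
have sz2 : size Vzs = size ts2 by rewrite !size_map size_iota size_tuple.
have u12 : u1 <> u2 by apply/eqP; rewrite /u1 /u2 neq_ltn ltnSn.
have zs_gt x : x \in zs -> (u2 < x)%N by rewrite mem_iota => /andP[].
have u1zs : u1 \notin zs by apply/negP=> /zs_gt; rewrite ltnNge leqnSn.
have u2zs : u2 \notin zs by apply/negP=> /zs_gt; rewrite ltnn.
have fresh x : (seq_tvars ts1 `|` seq_tvars ts2) x ->
    [/\ x <> u1, x <> u2 & x \notin zs].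
  move=> xt; have xb : (x < b)%N.
    by rewrite leq_max; case: xt => [/b1P ->|/b2P ->]; rewrite ?orbT.
  split; [apply/eqP|apply/eqP|].
  - by rewrite ltn_eqF.
  - by rewrite ltn_eqF // ltnW.
  - by apply/negP => /zs_gt; rewrite ltnNge ltnW // ltnW.
split.
  rewrite FV_Alls /= !FV_neq_terms // seq_tvars_Var.
  apply/seteqP; split=> x /=; first tauto.
  by move=> xt; have [? ? /negP] := fresh x xt; tauto.
have VzsE M (w : assignment M) : map (tval w) Vzs = map w zs.
  by rewrite -map_comp.
move=> M D X XD /=; rewrite subUset => -[ts1D ts2D] _.
rewrite sat_Alls /=.
pose agree (w s : assignment M) :=
  forall x, (seq_tvars ts1 `|` seq_tvars ts2) x -> w x = s x.
have agree1 w s : agree w s -> map (tval w) ts1 = map (tval s) ts1.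
  by move=> ws; apply: map_tval_agree => x xt; apply: ws; left.
have agree2 w s : agree w s -> map (tval w) ts2 = map (tval s) ts2.
  by move=> ws; apply: map_tval_agree => x xt; apply: ws; right.
have updE (w : assignment M) m1 m2 x : x <> u1 -> x <> u2 ->
    update (update w u1 m1) u2 m2 x = w x.
  by move=> x1 x2; rewrite update_neq ?update_neq.
have updzs (w : assignment M) m1 m2 :
    map (update (update w u1 m1) u2 m2) zs = map w zs.
  by apply/eq_in_map => x xzs; apply: updE => xu;
    move: xzs; rewrite xu; apply/negP.
have updu1 (w : assignment M) m1 m2 :
    update (update w u1 m1) u2 m2 u1 = Some m1.
  by rewrite update_neq // update_eq.
split=> [exc|[H1 [H1P [H2 [H2P [dep1 [dep2 [Y [Z [XYZ]]]]]]]]]].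
  have [a [c ac]] := Dom_ge2 M.
  (* [P w] says that the tuple [zs] takes in [w] is a value of [ts1] on [X]. With [u1] constantly
     [a] and [u2] equal to [bit w], the equation [u1 = u2] marks exactly the tuples that are not
     such values. Two distinct elements are needed for this coding. *)
  pose P (w : assignment M) :=
    exists2 s, X s & map w zs = map (tval s) ts1.
  pose bit w := if `[< P w >] then c else a.
  (* This gives the dependence of [u2] on [zs]. *)
  have bitE w w' : map w zs = map w' zs -> bit w = bit w'.
    by rewrite /bit /P => ->.
  exists (fun=> [set a]); split=> [w _|]; first by exists a.
  exists (fun w => [set bit w]); split=> [w _|]; first by exists (bit w).
  set W := supplement _ _ u2.
  have WP w : W w -> [/\ w u1 = Some a, w u2 = Some (bit w) &
                         exists2 s, X s & agree w s].
    case=> _ [_ [[w0 [_ [Xw0 -> ->]]] -> ->]].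
    rewrite updu1 update_eq; split=> //.
      congr Some; apply: bitE; rewrite updzs.
      by apply/eq_in_map => x xzs; rewrite update_neq // => xu;
         move: xzs; rewrite xu; apply/negP.
    have [s Xs w0s] := duplicates_origin Xw0; exists s => // x xt.
    by have [x1 x2 xzs] := fresh x xt; rewrite updE // w0s.
  split; [|split].
  - by move=> w w' /WP[-> _ _] /WP[-> _ _].
  - by move=> w w' /WP[_ -> _] /WP[_ -> _]; rewrite !VzsE => /bitE ->.
  exists (W `&` [set w | ~ P w]), (W `&` P); split.
  - apply/seteqP; split=> w; last by case=> -[].
    by move=> Ww; have [E|E] := pselect (P w); [right|left].
  - split=> [w [/WP[-> -> _] nP]|].
      by rewrite /bit asboolF.
    apply/sat_neq_terms => // w [/WP[_ _ [s Xs ws]] nP].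
    by rewrite VzsE => E; apply: nP; exists s => //; rewrite E (agree1 _ _ ws).
  - split=> [w [/WP[-> -> _] Pw]|].
      by rewrite /bit asboolT // => -[].
    apply/sat_neq_terms => // w [/WP[_ _ [s Xs ws]] [s' Xs' ws']].
    (* Here [zs] carries the value of [ts1] at [s'], which by exclusion differs from that of [ts2]
       at [s]. *)
    by rewrite VzsE ws' (agree2 _ _ ws); exact: exc.
move=> [Yu /(sat_neq_terms _ _ _ sz1) Y1] [Zu /(sat_neq_terms _ _ _ sz2) Z2].
move=> s s' Xs Xs' E.
(* Conversely, let [vs] be a common value of [ts1] at [s] and [ts2] at [s']. Both assignments are
   extended by giving [zs] the value [vs]; the dependence atoms then force equal [u1] and equal
   [u2]. *)
have [vs vsE] : exists vs : seq M, map (tval s) ts1 = map Some vs.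
  by apply: map_tval_defined => x /ts1D; rewrite (XD s Xs).
have vssz : size vs = size zs.
  by rewrite -(size_map Some) -vsE !size_map size_iota size_tuple.
have ext r : X r -> exists w,
    [/\ (Y `|` Z) w, map w zs = map Some vs & agree w r].
  move=> Xr; have [w [Xw wzs wr]] := duplicates_values (iota_uniq _ _) vssz Xr.
  have [m1 H1m] := H1P w Xw.
  have Xw1 : supplement (duplicates X zs) H1 u1 (update w u1 m1) by exists w, m1.
  have [m2 H2m] := H2P _ Xw1.
  exists (update (update w u1 m1) u2 m2); split.
  - by rewrite -XYZ; exists (update w u1 m1), m2.
  - by rewrite updzs.
  by move=> x /fresh[x1 x2 xzs]; rewrite updE // wr.
have [w [Ww wzs ws]] := ext s Xs; have [w' [Ww' wzs' ws']] := ext s' Xs'.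
have Ezs : map (tval w) Vzs = map (tval w') Vzs by rewrite !VzsE wzs wzs'.
rewrite -XYZ in Ww Ww'.
have Eu1 := dep1 w w' Ww Ww' Ezs; have Eu2 := dep2 w w' Ww Ww' Ezs.
rewrite XYZ in Ww Ww'.
(* In [w] the tuple [zs] equals [ts1], which rules out [Y]; so [u1] and [u2] differ in [w], hence in
   [w']. Thus [w'] is in [Z], although there [zs] equals [ts2]. *)
case: Ww => [Yw|/Zu].
  by apply: (Y1 w Yw); rewrite VzsE wzs (agree1 _ _ ws).
rewrite /= in Eu1 Eu2 *; rewrite Eu1 Eu2.
case: Ww' => [/Yu //|Zw'] _.
by apply: (Z2 w' Zw'); rewrite VzsE wzs' (agree2 _ _ ws') -E.
Qed.

(** Making the target logic a function of the source lets one statement cover both directions. *)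
Definition other (L : logic) : logic :=
  match L with Dependence => Exclusion | Exclusion => Dependence end.

Lemma atom_translation L (a : atom S L) :
  exists phi : formula S (other L),
    FV phi = avars a /\ team_equiv (Atom a) phi.
Proof.
by case: a => [ts t|n ts1 ts2];
  [exact: DepAtom_as_exclusion|exact: ExcAtom_as_dependence].
Qed.

End Formulas.

Theorem corollary4p20 (S : signature) :
  [/\ (forall phi : formula S Dependence,
         exists phi' : formula S Exclusion, team_equiv phi phi'),
      (forall phi : formula S Exclusion,
         exists phi' : formula S Dependence, team_equiv phi phi'),
      (forall phi : formula S Dependence, sentence phi ->
         exists phi' : formula S Exclusion,
           sentence phi' /\ sentence_equiv phi phi')
    & (forall phi : formula S Exclusion, sentence phi ->
         exists phi' : formula S Dependence,
           sentence phi' /\ sentence_equiv phi phi')].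
Proof.
have transl L phi := team_equiv_atoms (@atom_translation S L) phi.
split=> phi; try move=> phi0;
  have [phi' [phiF phiE]] := transl _ phi; exists phi' => //;
  exact: sentence_equiv_of_team_equiv.
Qed.
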